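(* For $x>0$ and each integer $n\ge0$ $$\mathrm{Gi}(x)=\frac{1}{\pi x}\sum_{k=0}^n\frac{(3k)!}{k!(3x^3)^k}+\frac1\pi\varepsilon_{2n+4}^{(\mathrm{Gi})}(x),\qquad \mathrm{Gi}'(x)=-\frac{1}{\pi x^2}\sum_{k=0}^n\frac{(3k+1)!}{k!(3x^3)^k}+\frac1\pi\tilde\varepsilon_{2n+5}^{(\mathrm{Gi})}(x),$$ where $$\left|\varepsilon_{2n+4}^{(\mathrm{Gi})}(x)\right|\le\frac{(3n+3)!}{3^{(5n/2)+3}(n+1)!\left(\tfrac12x\right)^{3n+4}},\qquad\left|\tilde\varepsilon_{2n+5}^{(\mathrm{Gi})}(x)\right|\le\frac{(3n+4)!}{3^{(5n+7)/2}(n+1)!\left(\tfrac12x\right)^{3n+5}}.$$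
   Context: The Scorer function $\mathrm{Gi}$ is $\mathrm{Gi}(x)=\dfrac1\pi\displaystyle\int_0^\infty\sin\left(\tfrac13t^3+xt\right)dt$ for real $x$ (a conditionally convergent integral). The displayed expansions define the error terms. *)

(* Defs.v *)
From Stdlib Require Import Reals Factorial.
From Coquelicot Require Import Coquelicot.
Open Scope R_scope.

Definition Gi_integrand (x t : R) : R := sin (t ^ 3 / 3 + x * t).

(** The integral over [0, +oo) is only conditionally convergent, so it is the
    limit of the Riemann integrals over [0, T] as T tends to +oo. *)
Definition Gi (x : R) : R :=
  / PI * RInt_gen (Gi_integrand x) (at_point 0) (Rbar_locally p_infty).

(** [sum_f_R0 f n] is [f 0 + ... + f n]. *)
Definition Gi_expansion (n : nat) (x : R) : R :=
  / (PI * x) *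
  sum_f_R0 (fun k => INR (fact (3 * k)) /
                     (INR (fact k) * (3 * x ^ 3) ^ k)) n.

Definition Gi'_expansion (n : nat) (x : R) : R :=
  - (/ (PI * x ^ 2) *
     sum_f_R0 (fun k => INR (fact (3 * k + 1)) /
                        (INR (fact k) * (3 * x ^ 3) ^ k)) n).

(** The error terms are defined by the expansions themselves: they are the
    remainders, with the factor [1 / PI] taken out.  [Gi_error n] is the
    error term of index 2n+4 and [Gi'_error n] the one of index 2n+5. *)
Definition Gi_error (n : nat) (x : R) : R :=
  PI * (Gi x - Gi_expansion n x).

Definition Gi'_error (n : nat) (x : R) : R :=
  PI * (Derive Gi x - Gi'_expansion n x).

(* Main.v *)
Require Import Defs.
From Stdlib Require Import Reals Factorial Lra Lia.
From Coquelicot Require Import Coquelicot.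
Open Scope R_scope.

(** The idea is to turn the path of integration.  Since [PI * Gi x] is the
    imaginary part of the integral of [exp (i (z^3/3 + x z))] along the positive
    real axis, rotate that axis to the ray [z = s e^(i PI/3)].  There [z^3] is
    [- s^3], so the cubic term only contributes the phase [exp (- i s^3/3)],
    while the linear term contributes the decay
    [exp (- x cos (PI/6) s)]:

      [PI * Gi x = int_0^oo exp (- x cos (PI/6) s) sin (x s/2 + PI/3 - s^3/3) ds].

    The angle [PI/3] is what makes the stated constants come out: the cubic
    factor has modulus one, so its Taylor remainder in [s^3/3] is bounded by the
    first omitted term with constant one, and the linear exponential decays at
    rate [x sqrt 3 / 2], whose powers produce the half-integer powers of 3.

    Taylor's formula in [v = s^3/3] reduces the expansion to the moments of
    [exp (- lambda s)] with [lambda = x e^(- i PI/6)], which are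
    [j! / lambda^(j+1)] ([is_half_line_RInt_pow_damped]); for every retained term
    the phases add up to [PI/2 + m PI] for the [m]-th derivative, hence the real
    coefficients.  The remainder is dominated by
    [s^m (s^3/3)^(n+1) / (n+1)! exp (- x sqrt 3/2 s)], whose integral is exactly
    the stated bound ([half_line_RInt_ray_kernel_expansion]).

    Each derivative in [x] multiplies the integrand by [i z], that is by [s] and
    a rotation by [5 PI/6].  Thus all derivatives of the kernel have the
    same form, and a second-order Taylor estimate, integrated in [s], justifies
    differentiation under the integral sign
    ([is_derive_half_line_RInt_ray_kernel]).

    The rotation is carried out in real variables
    ([is_half_line_RInt_Gi_integrand]).  The segments
    [z = s w(u)], with [w(u)] on the chord from [1] to [e^(i PI/3)], interpolate
    between the two paths; by the Cauchy-Riemann equations the [u]-derivative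
    of the integrand is an [s]-derivative, so the integrals over [0, T] along the
    two paths differ by the integral along the chord from [T] to
    [T e^(i PI/3)], which tends to 0. *)

(** * Integrals over the half-line *)

Notation is_half_line_RInt f l :=
  (is_RInt_gen f (at_point 0) (Rbar_locally p_infty) l).
Notation half_line_RInt f :=
  (RInt_gen f (at_point 0) (Rbar_locally p_infty)).

Lemma ex_RInt_continuous_everywhere (f : R -> R) (a b : R) :
  (forall t, continuous f t) -> ex_RInt f a b.
Proof. intros Cf; apply (ex_RInt_continuous (V := R_CompleteNormedModule)); auto. Qed.

Lemma half_line_eventually (P : R * R -> Prop) :
  (forall T, 0 <= T -> P (0, T)) ->
  filter_prod (at_point 0) (Rbar_locally p_infty) P.
Proof.
  intros HP; apply Filter_prod with (fun a => a = 0) (fun T => 0 < T).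
  - reflexivity.
  - exists 0; auto.
  - intros a T -> HT; apply HP; lra.
Qed.

(** For an integrand continuous on the whole line, the filter-based integral is
    a limit of proper integrals, to which limit theorems apply. *)
Lemma is_half_line_RInt_is_lim (f : R -> R) (l : R) :
  (forall t, continuous f t) ->
  is_half_line_RInt f l <-> is_lim (RInt f 0) p_infty l.
Proof.
  intros Cf; split.
  - intros Hf P HP.
    destruct (Hf P HP) as [Q S HQ HS H].
    unfold filtermap; apply filter_imp with (2 := HS).
    intros T HT; destruct (H 0 T HQ HT) as [v [Hv Pv]].
    now rewrite (is_RInt_unique _ _ _ _ Hv : RInt f 0 T = v).
  - intros Hf P HP.
    apply Filter_prod with (fun a => a = 0) (fun T => P (RInt f 0 T)).
    + reflexivity.
    + exact (Hf P HP).
    + intros a T -> HT; exists (RInt f 0 T); split; [|exact HT].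
      apply (RInt_correct (V := R_CompleteNormedModule)), ex_RInt_continuous_everywhere, Cf.
Qed.

Lemma half_line_RInt_unique (f : R -> R) (l : R) :
  is_half_line_RInt f l -> half_line_RInt f = l.
Proof. intros H; now apply is_RInt_gen_unique. Qed.

Lemma half_line_RInt_correct (f : R -> R) :
  ex_RInt_gen f (at_point 0) (Rbar_locally p_infty) ->
  is_half_line_RInt f (half_line_RInt f).
Proof.
  intros H; apply (RInt_gen_correct (V := R_CompleteNormedModule)); exact H.
Qed.

Lemma is_half_line_RInt_ext (f g : R -> R) (l : R) :
  (forall t, 0 <= t -> f t = g t) ->
  is_half_line_RInt f l -> is_half_line_RInt g l.
Proof.
  intros E; apply is_RInt_gen_ext.
  apply half_line_eventually; simpl; intros T HT t.
  rewrite Rmin_left, Rmax_right by lra; intros; apply E; lra.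
Qed.

Lemma is_half_line_RInt_primitive (F f : R -> R) :
  (forall t, is_derive F t (f t)) -> (forall t, continuous f t) ->
  is_lim F p_infty 0 -> is_half_line_RInt f (- F 0).
Proof.
  intros dF Cf LF; apply is_half_line_RInt_is_lim; [exact Cf|].
  apply is_lim_ext with (fun T => F T - F 0).
  - intros T; symmetry; apply is_RInt_unique.
    apply (is_RInt_derive (V := R_CompleteNormedModule)); auto.
  - replace (Finite (- F 0)) with (Finite (0 - F 0)) by (f_equal; lra).
    apply is_lim_minus'; [exact LF | apply is_lim_const].
Qed.

(** Cauchy's criterion: on [S, T] the increment of the integral of [f] is bounded
    by that of the integral of [g], which is small because the latter
    converges. *)
Lemma ex_half_line_RInt_dominated (f g : R -> R) :
  (forall t, continuous f t) -> (forall t, continuous g t) ->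
  (forall t, 0 <= t -> Rabs (f t) <= g t) ->
  ex_RInt_gen g (at_point 0) (Rbar_locally p_infty) ->
  ex_RInt_gen f (at_point 0) (Rbar_locally p_infty).
Proof.
  intros Cf Cg Hfg [lg Hg].
  assert (HC : exists l : R, filterlim (RInt f 0) (Rbar_locally p_infty) (locally l)).
  { apply (proj1 (filterlim_locally_cauchy (U := R_CompleteSpace) (RInt f 0))).
    apply (proj1 (is_half_line_RInt_is_lim g lg Cg)) in Hg.
    intros eps.
    destruct (proj2 (filterlim_locally_cauchy (U := R_CompleteSpace) (F := Rbar_locally p_infty) (RInt g 0))
      (ex_intro _ lg Hg) eps) as [P [HP Hball]].
    exists (fun T => P T /\ 0 < T); split.
    { apply filter_and; [exact HP | exists 0; auto]. }
    assert (H : forall S T, 0 < S <= T -> Rabs (RInt f 0 T - RInt f 0 S) <= Rabs (RInt g 0 T - RInt g 0 S)).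
    { intros S T HST.
      assert (E : forall h, (forall t, continuous h t) -> RInt h 0 T - RInt h 0 S = RInt h S T).
      { intros h Ch.
        rewrite <- (RInt_Chasles (V := R_CompleteNormedModule) h 0 S T);
          [unfold plus; simpl; ring | |]; now apply ex_RInt_continuous_everywhere. }
      rewrite !E by assumption.
      apply Rle_trans with (RInt g S T); [|apply Rle_abs].
      apply (norm_RInt_le (V := R_NormedModule) f g S T); [lra | | |].
      - intros t Ht; apply Hfg; lra.
      - apply (RInt_correct (V := R_CompleteNormedModule)); now apply ex_RInt_continuous_everywhere.
      - apply (RInt_correct (V := R_CompleteNormedModule)); now apply ex_RInt_continuous_everywhere. }
    intros S T [PS HS] [PT HT].
    change (Rabs (RInt f 0 T - RInt f 0 S) < eps).
    destruct (Rle_dec S T) as [L|L].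
    - apply Rle_lt_trans with (1 := H S T (conj HS L)). apply (Hball S T PS PT).
    - rewrite Rabs_minus_sym. apply Rle_lt_trans with (1 := H T S ltac:(lra)).
      apply (Hball T S PT PS). }
  destruct HC as [l Hl]; exists l; now apply is_half_line_RInt_is_lim.
Qed.

Lemma half_line_RInt_Rabs_le (f g : R -> R) (lf lg : R) :
  (forall t, 0 <= t -> Rabs (f t) <= g t) ->
  is_half_line_RInt f lf -> is_half_line_RInt g lg -> Rabs lf <= lg.
Proof.
  intros H Hf Hg.
  apply (RInt_gen_norm (V := R_CompleteNormedModule) (Fa := at_point 0)
    (Fb := Rbar_locally p_infty) f g lf lg); [| |exact Hf|exact Hg];
  apply half_line_eventually; simpl; auto.
  intros T HT t Ht; apply H; lra.
Qed.

Lemma is_half_line_RInt_scal (f : R -> R) (c l : R) :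
  is_half_line_RInt f l -> is_half_line_RInt (fun t => c * f t) (c * l).
Proof. apply (is_RInt_gen_scal f c l). Qed.

Lemma is_half_line_RInt_plus (f g : R -> R) (lf lg : R) :
  is_half_line_RInt f lf -> is_half_line_RInt g lg ->
  is_half_line_RInt (fun t => f t + g t) (lf + lg).
Proof. apply (is_RInt_gen_plus f g lf lg). Qed.

Lemma is_half_line_RInt_minus (f g : R -> R) (lf lg : R) :
  is_half_line_RInt f lf -> is_half_line_RInt g lg ->
  is_half_line_RInt (fun t => f t - g t) (lf - lg).
Proof. apply (is_RInt_gen_minus f g lf lg). Qed.

Lemma is_half_line_RInt_sum (f : nat -> R -> R) (l : nat -> R) (n : nat) :
  (forall k, is_half_line_RInt (f k) (l k)) ->
  is_half_line_RInt (fun t => sum_f_R0 (fun k => f k t) n) (sum_f_R0 l n).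
Proof.
  intros H; induction n as [|n IH]; simpl; [apply H|].
  now apply is_half_line_RInt_plus.
Qed.

(** * Exponential decay *)

Lemma exp_pow (u : R) (n : nat) : exp u ^ n = exp (INR n * u).
Proof.
  induction n as [|n IH]; [now rewrite Rmult_0_l, exp_0|].
  rewrite <- tech_pow_Rmult, IH, <- exp_plus, S_INR; f_equal; ring.
Qed.

Lemma exp_ge_pow (j : nat) (u : R) : 0 <= u -> (u / INR (S j)) ^ S j <= exp u.
Proof.
  intros Hu.
  replace (exp u) with (exp (u / INR (S j)) ^ S j).
  - apply pow_incr; split.
    + apply Rdiv_le_0_compat; [lra | apply lt_0_INR; lia].
    + pose proof (exp_ineq1_le (u / INR (S j))); lra.
  - rewrite exp_pow. f_equal. field. apply not_0_INR; lia.
Qed.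

(** Quantitative decay from [exp (c s) >= (c s / (j+1))^(j+1)]: one more power
    than needed is available, and it leaves the factor [1/s]. *)
Lemma pow_exp_decay (j : nat) (c s : R) : 0 < c -> 0 < s ->
  s ^ j * exp (- (c * s)) <= (INR (S j) / c) ^ S j / s.
Proof.
  intros Hc Hs.
  assert (HS : 0 < INR (S j)) by (apply lt_0_INR; lia).
  pose proof (exp_ge_pow j (c * s) ltac:(nra)) as H.
  rewrite exp_Ropp.
  assert (0 < exp (c * s)) by apply exp_pos.
  apply Rmult_le_reg_r with (exp (c * s) * s); [nra|].
  replace (s ^ j * / exp (c * s) * (exp (c * s) * s)) with (s ^ S j) by (simpl; field; lra).
  replace ((INR (S j) / c) ^ S j / s * (exp (c * s) * s)) with ((INR (S j) / c) ^ S j * exp (c * s)) by (field; lra).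
  apply Rle_trans with ((INR (S j) / c) ^ S j * (c * s / INR (S j)) ^ S j).
  - rewrite <- Rpow_mult_distr. right; f_equal; field; lra.
  - apply Rmult_le_compat_l; [|exact H].
    apply pow_le, Rdiv_le_0_compat; lra.
Qed.

Lemma is_lim_pow_exp_0 (j : nat) (c : R) : 0 < c ->
  is_lim (fun s => s ^ j * exp (- (c * s))) p_infty 0.
Proof.
  intros Hc.
  apply is_lim_le_le_loc with (fun _ => 0) (fun s => (INR (S j) / c) ^ S j * / s).
  - exists 0; intros s Hs; split.
    + apply Rmult_le_pos; [apply pow_le; lra | left; apply exp_pos].
    + now apply pow_exp_decay.
  - apply is_lim_const.
  - replace (Finite 0) with (Rbar_mult ((INR (S j) / c) ^ S j) 0) by (simpl; f_equal; ring).
    apply is_lim_scal_l. apply (is_lim_inv (fun s => s) p_infty p_infty).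
    + apply is_lim_id.
    + discriminate.
Qed.

Lemma is_lim_0_dominated (f g : R -> R) :
  (forall t, 0 < t -> Rabs (f t) <= g t) ->
  is_lim g p_infty 0 -> is_lim f p_infty 0.
Proof.
  intros H Lg. apply is_lim_le_le_loc with (fun t => - g t) g.
  - exists 0; intros t Ht; apply Rabs_le_between, H; lra.
  - replace (Finite 0) with (Rbar_opp 0) by (simpl; f_equal; ring). now apply is_lim_opp.
  - exact Lg.
Qed.

(** * Moments of damped oscillations *)

(** The imaginary part of [exp (i b - lambda s)] with
    [lambda = r e^(- i a)].  Phases are kept symbolic so that differentiation,
    which multiplies by [- lambda], is just a shift of [b]. *)
Definition damped (r a b s : R) : R :=
  exp (- (r * cos a * s)) * sin (r * sin a * s + b).

Lemma is_derive_damped (r a b s : R) :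
  is_derive (damped r a b) s (- r * damped r a (b - a) s).
Proof.
  unfold damped; auto_derive; [auto|].
  replace (r * sin a * s + (b - a)) with (r * sin a * s + b - a) by ring.
  rewrite sin_minus; ring.
Qed.

Lemma continuous_damped (r a b s : R) : continuous (damped r a b) s.
Proof.
  apply (ex_derive_continuous (V := R_NormedModule)); eexists; apply is_derive_damped.
Qed.

Lemma Rabs_exp_mult_le (u w : R) : Rabs w <= 1 -> Rabs (exp u * w) <= exp u.
Proof.
  intros H; rewrite Rabs_mult, (Rabs_pos_eq (exp u)) by (left; apply exp_pos).
  pose proof (exp_pos u); nra.
Qed.

Lemma Rabs_sin_le (u : R) : Rabs (sin u) <= 1.
Proof. apply Rabs_le, SIN_bound. Qed.

(** The imaginary part of [int_0^oo s^j exp (i b - lambda s) ds =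
    j! e^(i b) / lambda^(j+1)] with [lambda = r e^(- i a)].  Integration by parts
    lowers [j] by one, at the price of a factor [(j+1)/r] and a phase shift [a]. *)
Lemma is_half_line_RInt_pow_damped (j : nat) (r a b : R) :
  0 < r -> 0 < cos a ->
  is_half_line_RInt (fun s => s ^ j * damped r a b s)
    (INR (fact j) / r ^ S j * sin (b + INR (S j) * a)).
Proof.
  intros Hr Ha; revert b.
  (* boundary terms of the integrations by parts vanish at infinity *)
  assert (L : forall j b, is_lim (fun s => - / r * (s ^ j * damped r a b s)) p_infty 0).
  { intros i b. replace (Finite 0) with (Rbar_mult (- / r) 0) by (simpl; f_equal; ring).
    apply is_lim_scal_l.
    apply is_lim_0_dominated with (fun s => s ^ i * exp (- (r * cos a * s))).
    - intros s Hs. rewrite Rabs_mult, (Rabs_pos_eq (s ^ i)) by (apply pow_le; lra).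
      apply Rmult_le_compat_l; [apply pow_le; lra|].
      apply Rabs_exp_mult_le, Rabs_sin_le.
    - apply is_lim_pow_exp_0; nra. }
  assert (Cpow : forall j b s, continuous (fun s => s ^ j * damped r a b s) s).
  { intros i b s. apply (ex_derive_continuous (V := R_NormedModule)).
    apply ex_derive_mult; [auto_derive; auto | eexists; apply is_derive_damped]. }
  induction j as [|j IH]; intros b.
  - apply is_half_line_RInt_ext with (damped r a b); [intros; simpl; ring|].
    replace (_ / _ * _) with (- (- / r * (0 ^ 0 * damped r a (b + a) 0))).
    + apply (is_half_line_RInt_primitive (fun s => - / r * (s ^ 0 * damped r a (b + a) s)));
        [|intros; apply continuous_damped | apply L].
      intros s. apply is_derive_ext with (fun s => - / r * damped r a (b + a) s).
      { intros; simpl; ring. }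
      replace (damped r a b s) with (- / r * (- r * damped r a (b + a - a) s)).
      * apply (is_derive_scal (damped r a (b + a))), is_derive_damped.
      * replace (b + a - a) with b by ring. field; lra.
    + unfold damped. simpl. rewrite !Rmult_0_r, Ropp_0, exp_0, Rplus_0_l, !Rmult_1_l. field; lra.
  - (* F' is the moment integrand of order [S j] minus a multiple of the one of
       order [j], with phase moved by [a]; F vanishes at both ends. *)
    set (F := fun s => - / r * (s ^ S j * damped r a (b + a) s)).
    assert (H : is_half_line_RInt (fun s => s ^ S j * damped r a b s - INR (S j) / r * (s ^ j * damped r a (b + a) s)) (- F 0)).
    { apply is_half_line_RInt_primitive; [| | apply L].
      - intros s. unfold F.
        replace (_ - _) with (- / r * (INR (S j) * s ^ j * damped r a (b + a) s + s ^ S j * (- r * damped r a (b + a - a) s))).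
        + apply (is_derive_scal (fun s => s ^ S j * damped r a (b + a) s)).
          apply (is_derive_mult (fun s => s ^ S j) (damped r a (b + a))).
          * auto_derive; [auto | change (1 * (INR (S j) * s ^ j) = INR (S j) * s ^ j); ring].
          * apply is_derive_damped.
          * intros; apply Rmult_comm.
        + replace (b + a - a) with b by ring. field; lra.
      - intros s. apply (continuous_minus (V := R_NormedModule)); [apply (Cpow (S j) b)|].
        apply (continuous_scal_r (V := R_NormedModule)). apply Cpow. }
    specialize (IH (b + a)). apply (is_half_line_RInt_scal _ (INR (S j) / r)) in IH.
    pose proof (is_half_line_RInt_plus _ _ _ _ H IH) as H'.
    replace (_ / _ * sin _) with (- F 0 + INR (S j) / r * (INR (fact j) / r ^ S j * sin (b + a + INR (S j) * a))).
    + revert H'; apply is_half_line_RInt_ext; intros s _; ring.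
    + unfold F. rewrite pow_i by lia.
      replace (b + a + INR (S j) * a) with (b + INR (S (S j)) * a) by (rewrite (S_INR (S j)); ring).
      change (fact (S j)) with ((S j) * fact j)%nat. rewrite mult_INR.
      change (r ^ S (S j)) with (r * r ^ S j).
      field. split; [apply pow_nonzero |]; lra.
Qed.

(** * Taylor's formula and differentiation *)

Lemma Derive_n_family (g : nat -> R -> R) :
  (forall k t, is_derive (g k) t (g (S k) t)) ->
  forall k t, Derive_n (g 0%nat) k t = g k t.
Proof.
  intros dg; induction k as [|k IH]; intros t; [reflexivity|].
  simpl; rewrite (Derive_ext _ (g k)) by exact IH.
  apply is_derive_unique, dg.
Qed.

Lemma taylor_bound_right (g : nat -> R -> R) (n : nat) (a b M : R) :
  (forall k t, is_derive (g k) t (g (S k) t)) ->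
  a < b -> (forall t, a <= t <= b -> Rabs (g (S n) t) <= M) ->
  Rabs (g 0%nat b - sum_f_R0 (fun k => (b - a) ^ k / INR (fact k) * g k a) n)
  <= Rabs (b - a) ^ S n / INR (fact (S n)) * M.
Proof.
  intros dg Hab HM.
  destruct (Taylor_Lagrange (g 0%nat) n a b Hab) as [z [Hz E]].
  { intros t _ [|k] _; [exact I|].
    exists (g (S k) t); apply is_derive_ext with (g k); [|apply dg].
    intros u; symmetry; now apply Derive_n_family. }
  rewrite E, Derive_n_family by exact dg.
  rewrite (sum_eq _ (fun k => (b - a) ^ k / INR (fact k) * g k a)).
  2: { intros k _; now rewrite Derive_n_family by exact dg. }
  match goal with |- Rabs (?s + ?r - ?s) <= _ => replace (s + r - s) with r by ring end.
  assert (0 < INR (fact (S n))) by apply INR_fact_lt_0.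
  rewrite Rabs_mult; unfold Rdiv.
  rewrite Rabs_mult, (Rabs_pos_eq (/ _)), RPow_abs by (left; now apply Rinv_0_lt_compat).
  apply Rmult_le_compat_l; [|apply HM; lra].
  apply Rmult_le_pos; [apply Rabs_pos | left; now apply Rinv_0_lt_compat].
Qed.

(** The derivatives are supplied as a family [g]; base point and end point
    may come in either order, as differentiation under the integral needs
    increments of both signs. *)
Lemma taylor_bound (g : nat -> R -> R) (n : nat) (a b M : R) :
  (forall k t, is_derive (g k) t (g (S k) t)) ->
  (forall t, Rmin a b <= t <= Rmax a b -> Rabs (g (S n) t) <= M) ->
  Rabs (g 0%nat b - sum_f_R0 (fun k => (b - a) ^ k / INR (fact k) * g k a) n)
  <= Rabs (b - a) ^ S n / INR (fact (S n)) * M.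
Proof.
  intros dg HM.
  destruct (Rtotal_order a b) as [L|[->|L]].
  - apply taylor_bound_right; auto.
    intros t Ht; apply HM; rewrite Rmin_left, Rmax_right; lra.
  - rewrite Rminus_diag, Rabs_R0, pow_i by lia.
    assert (E : forall m, sum_f_R0 (fun k => 0 ^ k / INR (fact k) * g k b) m = g 0%nat b).
    { induction m as [|m IH]; [simpl; field|].
      rewrite tech5, IH, pow_i by lia. unfold Rdiv; ring. }
    rewrite E, Rminus_diag, Rabs_R0; unfold Rdiv; lra.
  - (* reflection [t |-> - t] exchanges the two orders *)
    pose (h := fun (k : nat) t => (-1) ^ k * g k (- t)).
    assert (dh : forall k t, is_derive (h k) t (h (S k) t)).
    { intros k t; unfold h.
      replace ((-1) ^ S k * g (S k) (- t)) with ((-1) ^ k * (-1 * g (S k) (- t))) by (simpl; ring).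
      apply (is_derive_scal (fun t => g k (- t))).
      apply (is_derive_comp (g k) Ropp); [apply dg | auto_derive; [auto | ring]]. }
    generalize (taylor_bound_right h n (- a) (- b) M dh ltac:(lra)).
    replace (h 0%nat (- b)) with (g 0%nat b) by (unfold h; rewrite Ropp_involutive; simpl; ring).
    rewrite (sum_eq _ (fun k => (b - a) ^ k / INR (fact k) * g k a)).
    2: { intros k _; unfold h; rewrite Ropp_involutive.
         replace (- b - - a) with (-1 * (b - a)) by ring.
         assert (E : (-1) ^ k * (-1) ^ k = 1)
           by (rewrite <- Rpow_mult_distr; replace (-1 * -1) with 1 by ring; apply pow1).
         rewrite Rpow_mult_distr. unfold Rdiv.
         transitivity (((-1) ^ k * (-1) ^ k) * ((b - a) ^ k * / INR (fact k) * g k a)); [ring|].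
         rewrite E; ring. }
    replace (Rabs (- b - - a)) with (Rabs (b - a)) by (rewrite <- Rabs_Ropp; f_equal; ring).
    intros H; apply H. intros t Ht; unfold h.
    rewrite Rabs_mult, pow_1_abs, Rmult_1_l; apply HM.
    rewrite Rmin_right, Rmax_left; lra.
Qed.

Lemma is_derive_quadratic_error (f : R -> R) (x l C d : R) :
  0 < d ->
  (forall y, Rabs (y - x) < d -> Rabs (f y - f x - (y - x) * l) <= C * (y - x) ^ 2) ->
  is_derive f x l.
Proof.
  intros Hd HC; apply is_derive_Reals; intros eps Heps.
  assert (HC1 : 0 < Rabs C + 1) by (pose proof (Rabs_pos C); lra).
  assert (Hr : 0 < Rmin d (eps / (Rabs C + 1))).
  { apply Rmin_pos; [exact Hd | now apply Rdiv_lt_0_compat]. }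
  exists (mkposreal _ Hr); simpl; intros h Hh Hhd.
  assert (Hh1 : Rabs h < d) by (eapply Rlt_le_trans; [exact Hhd | apply Rmin_l]).
  assert (Hh2 : Rabs h < eps / (Rabs C + 1)) by (eapply Rlt_le_trans; [exact Hhd | apply Rmin_r]).
  specialize (HC (x + h)). replace (x + h - x) with h in HC by ring. specialize (HC Hh1).
  replace ((f (x + h) - f x) / h - l) with ((f (x + h) - f x - h * l) / h) by (field; exact Hh).
  pose proof (Rabs_pos_lt h Hh) as Ph.
  unfold Rdiv; rewrite Rabs_mult, Rabs_inv.
  apply Rmult_lt_reg_r with (Rabs h); [exact Ph|].
  rewrite Rmult_assoc, Rinv_l, Rmult_1_r by lra.
  apply Rle_lt_trans with (1 := HC).
  rewrite <- pow2_abs.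
  apply Rlt_div_r in Hh2; [|exact HC1].
  pose proof (Rle_abs C). pose proof (Rabs_pos C). nra.
Qed.

(** * The integrand along the ray of angle PI/3 *)

(** The imaginary part of [(i z)^k exp (i (z^3/3 + y z)) dz/ds] on
    [z = s e^(i PI/3)].  The phase [PI/3] comes from [dz/ds], and each factor
    [i z = s e^(5 i PI/6)] adds [5 PI/6]. *)
Definition ray_kernel (k : nat) (y s : R) : R :=
  s ^ k * damped y (PI / 6) (PI / 3 + INR k * (5 * PI / 6) - s ^ 3 / 3) s.

Lemma is_derive_ray_kernel (k : nat) (y s : R) :
  is_derive (fun y => ray_kernel k y s) y (ray_kernel (S k) y s).
Proof.
  unfold ray_kernel, damped; auto_derive; [auto|].
  change (s ^ S k) with (s * s ^ k).
  replace (y * sin (PI / 6) * s + (PI / 3 + INR (S k) * (5 * PI / 6) - s ^ 3 / 3))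
    with (y * sin (PI / 6) * s + (PI / 3 + INR k * (5 * PI / 6) - s ^ 3 / 3) - PI / 6 + PI)
    by (rewrite S_INR; field).
  rewrite neg_sin, sin_minus.
  change (s * (s * (s * 1))) with (s ^ 3).
  ring.
Qed.

Lemma continuous_ray_kernel (k : nat) (y s : R) : continuous (ray_kernel k y) s.
Proof.
  apply (ex_derive_continuous (V := R_NormedModule)).
  unfold ray_kernel, damped; auto_derive; auto.
Qed.

Lemma Rabs_ray_kernel_le (k : nat) (y s : R) :
  0 <= s -> Rabs (ray_kernel k y s) <= s ^ k * exp (- (y * cos (PI / 6) * s)).
Proof.
  intros Hs; unfold ray_kernel.
  rewrite Rabs_mult, (Rabs_pos_eq (s ^ k)) by now apply pow_le.
  apply Rmult_le_compat_l; [now apply pow_le|].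
  apply Rabs_exp_mult_le, Rabs_sin_le.
Qed.

(** [damped] with angle 0 and phase [PI/2] is a pure exponential. *)
Lemma is_half_line_RInt_pow_exp (j : nat) (c : R) : 0 < c ->
  is_half_line_RInt (fun s => s ^ j * exp (- (c * s))) (INR (fact j) / c ^ S j).
Proof.
  intros Hc.
  pose proof (is_half_line_RInt_pow_damped j c 0 (PI / 2) Hc) as H.
  rewrite cos_0, Rmult_0_r, Rplus_0_r, sin_PI2, Rmult_1_r in H.
  specialize (H Rlt_0_1); revert H; apply is_half_line_RInt_ext; intros s _.
  unfold damped; rewrite cos_0, sin_0, Rmult_1_r, Rmult_0_r, Rmult_0_l, Rplus_0_l, sin_PI2; ring.
Qed.

Lemma cos_PI6_pos : 0 < cos (PI / 6).
Proof. rewrite cos_PI6; pose proof (sqrt_lt_R0 3); lra. Qed.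

Lemma is_half_line_RInt_ray_kernel (k : nat) (y : R) : 0 < y ->
  is_half_line_RInt (ray_kernel k y) (half_line_RInt (ray_kernel k y)).
Proof.
  intros Hy; apply half_line_RInt_correct.
  apply ex_half_line_RInt_dominated with (fun s => s ^ k * exp (- (y * cos (PI / 6) * s))).
  - apply continuous_ray_kernel.
  - intros s; apply (ex_derive_continuous (V := R_NormedModule)); auto_derive; auto.
  - intros s; apply Rabs_ray_kernel_le.
  - eexists; apply is_half_line_RInt_pow_exp.
    apply Rmult_lt_0_compat; [exact Hy | apply cos_PI6_pos].
Qed.

(** Differentiation under the integral sign: for [y > x/2] the second
    derivative of the kernel is dominated by [s^(k+2) exp (- c s)] with the rate
    [c] belonging to [x/2], so the linearization error of the integral is
    [O((y - x)^2)]. *)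
Lemma is_derive_half_line_RInt_ray_kernel (k : nat) (x : R) : 0 < x ->
  is_derive (fun y => half_line_RInt (ray_kernel k y)) x
    (half_line_RInt (ray_kernel (S k) x)).
Proof.
  intros Hx.
  set (c := x / 2 * cos (PI / 6)).
  assert (Hc : 0 < c) by (apply Rmult_lt_0_compat; [lra | apply cos_PI6_pos]).
  set (Q := INR (fact (k + 2)) / c ^ S (k + 2)).
  apply is_derive_quadratic_error with (/ 2 * Q) (x / 2); [lra|].
  intros y Hy; apply Rabs_lt_between in Hy.
  replace (/ 2 * Q * (y - x) ^ 2) with ((y - x) ^ 2 / 2 * Q) by field.
  eapply half_line_RInt_Rabs_le with
    (g := fun s => (y - x) ^ 2 / 2 * (s ^ (k + 2) * exp (- (c * s)))).
  2: { apply is_half_line_RInt_minus.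
       - apply is_half_line_RInt_minus; apply is_half_line_RInt_ray_kernel; lra.
       - apply is_half_line_RInt_scal, is_half_line_RInt_ray_kernel; lra. }
  2: { now apply is_half_line_RInt_scal, is_half_line_RInt_pow_exp. }
  intros s Hs.
  pose proof (taylor_bound (fun i u => ray_kernel (i + k) u s) 1 x y
    (s ^ (k + 2) * exp (- (c * s)))
    (fun i u => is_derive_ray_kernel (i + k) u s)) as H.
  simpl sum_f_R0 in H; simpl Nat.add in H; simpl fact in H.
  cbv beta.
  replace (ray_kernel k y s - ray_kernel k x s - (y - x) * ray_kernel (S k) x s) with
    (ray_kernel k y s - (1 / 1 * ray_kernel k x s + (y - x) * 1 / 1 * ray_kernel (S k) x s))
    by field.
  replace ((y - x) ^ 2 / 2) with (Rabs (y - x) ^ 2 / INR 2) by (rewrite pow2_abs; reflexivity).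
  apply H; clear H; intros u Hu.
  rewrite (Nat.add_comm k 2).
  apply Rle_trans with (1 := Rabs_ray_kernel_le (2 + k) u s Hs).
  apply Rmult_le_compat_l; [now apply pow_le|].
  assert (Hux : x / 2 <= u).
  { destruct (Rle_dec x y); [rewrite Rmin_left in Hu | rewrite Rmin_right in Hu]; lra. }
  pose proof cos_PI6_pos.
  destruct (Req_dec (- (u * cos (PI / 6) * s)) (- (c * s))) as [->|N]; [lra|].
  left; apply exp_increasing. unfold c in *.
  assert (x / 2 * cos (PI / 6) * s <= u * cos (PI / 6) * s).
  { apply Rmult_le_compat_r; [lra|]. apply Rmult_le_compat_r; lra. }
  lra.
Qed.

(** * Expansion of the integral along the ray *)

Lemma is_derive_sin_shift (A : R) (k : nat) (v : R) :
  is_derive (fun v => sin (A - INR k * (PI / 2) - v)) v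
    (sin (A - INR (S k) * (PI / 2) - v)).
Proof.
  auto_derive; [auto|].
  replace (A - INR (S k) * (PI / 2) - v) with (- (PI / 2 - (A - INR k * (PI / 2) - v)))
    by (rewrite S_INR; field).
  rewrite sin_neg, sin_shift; unfold Rminus; ring.
Qed.

(** The derivatives of [v |-> sin (A - v)] are its phase shifts by [- PI/2], all
    bounded by 1, so the remainder is at most the first omitted term. *)
Lemma sin_minus_taylor (A v : R) (n : nat) : 0 <= v ->
  Rabs (sin (A - v) - sum_f_R0 (fun k => v ^ k / INR (fact k) * sin (A - INR k * (PI / 2))) n)
  <= v ^ S n / INR (fact (S n)).
Proof.
  intros Hv.
  pose proof (taylor_bound (fun k v => sin (A - INR k * (PI / 2) - v)) n 0 v 1
    (is_derive_sin_shift A) (fun t _ => Rabs_sin_le _)) as H.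
  rewrite Rminus_0_r, Rmult_1_r, (Rabs_pos_eq v) in H by exact Hv.
  simpl (INR 0) in H; rewrite Rmult_0_l, Rminus_0_r in H.
  erewrite sum_eq; [exact H|].
  intros k _; simpl; now rewrite Rminus_0_r.
Qed.

Definition moment_sum (m n : nat) (x : R) : R :=
  sum_f_R0 (fun k => INR (fact (3 * k + m)) /
     (3 ^ k * INR (fact k) * x ^ S (3 * k + m))) n.

Lemma sin_PI2_plus_mult_PI (m : nat) : sin (PI / 2 + INR m * PI) = (-1) ^ m.
Proof.
  induction m as [|m IH]; [simpl; rewrite Rmult_0_l, Rplus_0_r; apply sin_PI2|].
  rewrite S_INR. replace (PI / 2 + (INR m + 1) * PI) with (PI / 2 + INR m * PI + PI) by ring.
  rewrite neg_sin, IH; simpl; ring.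
Qed.

(** Taylor's formula in [v = s^3/3], applied to the phase of the kernel and
    integrated term by term.  The [k]-th term has phase
    [PI/3 + 5 m PI/6 - k PI/2] and moment order [3 k + m]; adding
    [(3 k + m + 1) PI/6] gives [PI/2 + m PI] for every [k], hence the common
    sign [(-1)^m]. *)
Lemma half_line_RInt_ray_kernel_expansion (m n : nat) (x : R) : 0 < x ->
  Rabs (half_line_RInt (ray_kernel m x) - (-1) ^ m * moment_sum m n x)
  <= INR (fact (3 * S n + m)) /
     (3 ^ S n * INR (fact (S n)) * (x * cos (PI / 6)) ^ S (3 * S n + m)).
Proof.
  intros Hx.
  pose (A := fun s => x * sin (PI / 6) * s + (PI / 3 + INR m * (5 * PI / 6))).
  pose (term := fun (k : nat) s => / (3 ^ k * INR (fact k)) *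
    (s ^ (3 * k + m) * damped x (PI / 6) (PI / 3 + INR m * (5 * PI / 6) - INR k * (PI / 2)) s)).
  assert (Hfact : forall k, 0 < INR (fact k)) by (intros; apply INR_fact_lt_0).
  assert (H3 : forall k, 0 < 3 ^ k) by (intros; apply pow_lt; lra).
  assert (Hterm : forall k, is_half_line_RInt (term k)
    ((-1) ^ m * (INR (fact (3 * k + m)) / (3 ^ k * INR (fact k) * x ^ S (3 * k + m))))).
  { intros k.
    replace (_ * _) with (/ (3 ^ k * INR (fact k)) * (INR (fact (3 * k + m)) / x ^ S (3 * k + m) *
      sin (PI / 3 + INR m * (5 * PI / 6) - INR k * (PI / 2) + INR (S (3 * k + m)) * (PI / 6)))).
    - apply is_half_line_RInt_scal, is_half_line_RInt_pow_damped; [lra | apply cos_PI6_pos].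
    - replace (_ + INR (S (3 * k + m)) * (PI / 6)) with (PI / 2 + INR m * PI)
        by (rewrite S_INR, plus_INR, mult_INR; simpl; field).
      rewrite sin_PI2_plus_mult_PI.
      specialize (Hfact k); specialize (H3 k).
      field; repeat split; try apply pow_nonzero; lra. }
  replace ((-1) ^ m * moment_sum m n x) with
    (sum_f_R0 (fun k => (-1) ^ m * (INR (fact (3 * k + m)) / (3 ^ k * INR (fact k) * x ^ S (3 * k + m)))) n)
    by (unfold moment_sum; rewrite scal_sum; apply sum_eq; intros; ring).
  replace (_ / (_ * _ * (x * cos (PI / 6)) ^ S (3 * S n + m))) with
    (/ (3 ^ S n * INR (fact (S n))) * (INR (fact (3 * S n + m)) / (x * cos (PI / 6)) ^ S (3 * S n + m))).
  2: { specialize (Hfact (S n)); specialize (H3 (S n)); pose proof cos_PI6_pos.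
       field; repeat split; try apply pow_nonzero; try lra; nra. }
  apply half_line_RInt_Rabs_le with
    (f := fun s => ray_kernel m x s - sum_f_R0 (fun k => term k s) n)
    (g := fun s => / (3 ^ S n * INR (fact (S n))) * (s ^ (3 * S n + m) * exp (- (x * cos (PI / 6) * s)))).
  - intros s Hs.
    pose (e := exp (- (x * cos (PI / 6) * s))).
    assert (He : 0 < e) by apply exp_pos.
    replace (ray_kernel m x s - sum_f_R0 (fun k => term k s) n) with
      (s ^ m * e * (sin (A s - s ^ 3 / 3) -
        sum_f_R0 (fun k => (s ^ 3 / 3) ^ k / INR (fact k) * sin (A s - INR k * (PI / 2))) n)).
    + rewrite Rabs_mult, Rabs_pos_eq by (apply Rmult_le_pos; [now apply pow_le | lra]).
      replace (/ _ * _) with (s ^ m * e * ((s ^ 3 / 3) ^ S n / INR (fact (S n)))).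
      * apply Rmult_le_compat_l; [apply Rmult_le_pos; [now apply pow_le | lra]|].
        apply sin_minus_taylor. apply Rdiv_le_0_compat; [now apply pow_le | lra].
      * fold e. unfold Rdiv; rewrite Rpow_mult_distr, pow_add, pow_mult, pow_inv.
        specialize (Hfact (S n)); specialize (H3 (S n)). field; lra.
    + rewrite Rmult_minus_distr_l, scal_sum. f_equal.
      * unfold ray_kernel, damped, A; fold e. rewrite Rmult_assoc; do 3 f_equal; ring.
      * apply sum_eq; intros k _. unfold term, damped, A; fold e.
        unfold Rdiv; rewrite Rpow_mult_distr, pow_add, pow_mult, pow_inv, Rinv_mult.
        replace (x * sin (PI * / 6) * s + (PI * / 3 + INR m * (5 * PI * / 6)) - INR k * (PI * / 2))
          with (x * sin (PI * / 6) * s + (PI * / 3 + INR m * (5 * PI * / 6) - INR k * (PI * / 2))) by ring.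
        ring.
  - apply is_half_line_RInt_minus; [now apply is_half_line_RInt_ray_kernel|].
    now apply is_half_line_RInt_sum.
  - apply is_half_line_RInt_scal, is_half_line_RInt_pow_exp.
    apply Rmult_lt_0_compat; [exact Hx | apply cos_PI6_pos].
Qed.

(** * Rotation of the path of integration *)

(** The imaginary part of [(c + i d) exp (i (z^3/3 + y z))] at [z = a + i b]. *)
Definition airy_im (y a b c d : R) : R :=
  exp (- ((3 * (a * a) * b - b * b * b) / 3 + y * b)) *
  (c * sin ((a * a * a - 3 * a * (b * b)) / 3 + y * a) +
   d * cos ((a * a * a - 3 * a * (b * b)) / 3 + y * a)).

(** The chord [w(u) = chord_re u + i chord_im u] from [1] to [e^(i PI/3)].  With it
    the imaginary part of [z^3] at [z = s w(u)] is a multiple of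
    [s^3 u (1 - u)], visibly nonnegative. *)
Definition chord_re (u : R) : R := 1 - u / 2.
Definition chord_im (u : R) : R := sqrt 3 / 2 * u.

(** The integrand [w exp (i (z^3/3 + y z))] at [z = s w(u)], from [dz = w ds]. *)
Definition chord_kernel (y u s : R) : R :=
  airy_im y (s * chord_re u) (s * chord_im u) (chord_re u) (chord_im u).

(** The integrand along the chord itself, where [dz = s w'(u) du]. *)
Definition chord_edge (y u s : R) : R :=
  airy_im y (s * chord_re u) (s * chord_im u) (s * - (1 / 2)) (s * (sqrt 3 / 2)).

(** The common value of the [u]-derivative of [chord_kernel] and the
    [s]-derivative of [chord_edge], namely [w' (1 + i z (z^2 + y))] times the
    exponential: here [m + i n = z^2 + y] and [c + i d = (m + i n) w']. *)
Definition chord_mixed (y u s : R) : R :=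
  let a := s * chord_re u in
  let b := s * chord_im u in
  let m := a * a - b * b + y in
  let n := 2 * a * b in
  let c := m * - (1 / 2) - n * (sqrt 3 / 2) in
  let d := m * (sqrt 3 / 2) + n * - (1 / 2) in
  airy_im y a b (- (1 / 2) - (a * d + b * c)) (sqrt 3 / 2 + (a * c - b * d)).

Lemma is_derive_chord_kernel (y u s : R) :
  is_derive (fun u => chord_kernel y u s) u (chord_mixed y u s).
Proof.
  unfold chord_mixed, chord_kernel, chord_re, chord_im, airy_im; cbv zeta.
  auto_derive; [auto|]. unfold Rminus, Rdiv; field.
Qed.

Lemma is_derive_chord_edge (y u s : R) :
  is_derive (chord_edge y u) s (chord_mixed y u s).
Proof.
  unfold chord_mixed, chord_edge, chord_re, chord_im, airy_im; cbv zeta.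
  auto_derive; [auto|]. unfold Rminus, Rdiv; field.
Qed.

Ltac continuity_2d :=
  first
  [ apply continuity_2d_pt_const | apply continuity_2d_pt_id1 | apply continuity_2d_pt_id2
  | apply continuity_2d_pt_opp; continuity_2d
  | apply continuity_2d_pt_plus; continuity_2d
  | apply continuity_2d_pt_mult; continuity_2d
  | apply (continuity_1d_2d_pt_comp exp);
      [apply derivable_continuous_pt, derivable_pt_exp | continuity_2d]
  | apply (continuity_1d_2d_pt_comp sin); [apply continuity_sin | continuity_2d]
  | apply (continuity_1d_2d_pt_comp cos); [apply continuity_cos | continuity_2d] ].

Lemma continuity_2d_chord_mixed (y u s : R) :
  continuity_2d_pt (chord_mixed y) u s.
Proof.
  unfold chord_mixed, chord_re, chord_im, airy_im, Rminus, Rdiv; cbv zeta.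
  continuity_2d.
Qed.

Lemma continuous_chord_kernel (y u s : R) : continuous (chord_kernel y u) s.
Proof.
  apply (ex_derive_continuous (V := R_NormedModule)).
  unfold chord_kernel, airy_im; auto_derive; auto.
Qed.

Lemma continuous_chord_mixed (y u s : R) : continuous (chord_mixed y u) s.
Proof.
  apply (ex_derive_continuous (V := R_NormedModule)).
  unfold chord_mixed, airy_im; auto_derive; auto.
Qed.

Lemma continuous_chord_edge (y u s : R) : continuous (fun u => chord_edge y u s) u.
Proof.
  apply (ex_derive_continuous (V := R_NormedModule)).
  unfold chord_edge, chord_re, chord_im, airy_im; auto_derive; auto.
Qed.

(** Differentiating under the integral gives the integral of [chord_mixed],
    which [chord_edge] evaluates; at [s = 0] the edge term vanishes. *)
Lemma is_derive_RInt_chord_kernel (y T u : R) :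
  is_derive (fun u => RInt (chord_kernel y u) 0 T) u (chord_edge y u T).
Proof.
  assert (E : forall v s, Derive (fun v => chord_kernel y v s) v = chord_mixed y v s)
    by (intros; apply is_derive_unique, is_derive_chord_kernel).
  replace (chord_edge y u T) with (RInt (fun s => Derive (fun v => chord_kernel y v s) u) 0 T).
  - apply (is_derive_RInt_param (chord_kernel y) 0 T u).
    + apply filter_forall; intros v s _; eexists; apply is_derive_chord_kernel.
    + intros s _; apply continuity_2d_pt_ext with (chord_mixed y);
        [intros; symmetry; apply E | apply continuity_2d_chord_mixed].
    + apply filter_forall; intros v.
      apply ex_RInt_continuous_everywhere, continuous_chord_kernel.
  - rewrite (RInt_ext _ (chord_mixed y u)) by (intros; apply E).
    replace (chord_edge y u T) with (minus (chord_edge y u T) (chord_edge y u 0)).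
    + apply is_RInt_unique.
      apply (is_RInt_derive (V := R_CompleteNormedModule)); intros;
        [apply is_derive_chord_edge | apply continuous_chord_mixed].
    + unfold minus, plus, opp, chord_edge, airy_im; simpl; ring.
Qed.

(** Cauchy's theorem for the triangle with vertices [0], [T] and
    [T e^(i PI/3)]. *)
Lemma RInt_chord_kernel_ends (y T : R) :
  RInt (chord_kernel y 1) 0 T - RInt (chord_kernel y 0) 0 T =
  RInt (fun u => chord_edge y u T) 0 1.
Proof.
  symmetry; apply is_RInt_unique.
  apply (is_RInt_derive (V := R_CompleteNormedModule)
    (fun u => RInt (chord_kernel y u) 0 T)); intros;
    [apply is_derive_RInt_chord_kernel | apply continuous_chord_edge].
Qed.

Lemma chord_kernel_0 (y s : R) : chord_kernel y 0 s = Gi_integrand y s.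
Proof.
  unfold chord_kernel, chord_re, chord_im, airy_im, Gi_integrand.
  replace (- _) with 0 by field. rewrite exp_0.
  replace (sqrt 3 / 2 * 0) with 0 by ring.
  replace ((_ - _) / 3 + _) with (s ^ 3 / 3 + y * s) by field. field.
Qed.

Lemma sqrt3_sqr : sqrt 3 * sqrt 3 = 3.
Proof. apply sqrt_sqrt; lra. Qed.

Lemma chord_kernel_1 (y s : R) : chord_kernel y 1 s = ray_kernel 0 y s.
Proof.
  pose proof sqrt3_sqr as E.
  unfold chord_kernel, chord_re, chord_im, airy_im, ray_kernel, damped.
  simpl (INR 0); rewrite cos_PI6, sin_PI6, Rmult_0_l, Rplus_0_r.
  replace (y * (1 / 2) * s + (PI / 3 - s ^ 3 / 3)) with ((y * (1 / 2) * s - s ^ 3 / 3) + PI / 3) by ring.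
  rewrite (sin_plus _ (PI / 3)), cos_PI3, sin_PI3.
  set (r := sqrt 3) in *.
  (* on the ray [z^3] is real, as [sqrt 3] squared is 3 *)
  replace (- _) with (- (y * (r / 2) * s)).
  2: { transitivity (- ((3 - r * r) * r * (s * s * s) / 24 + y * (r / 2) * s)); [rewrite E|]; field. }
  replace ((_ - _) / 3 + y * (s * (1 - 1 / 2))) with (y * (1 / 2) * s - s ^ 3 / 3).
  2: { transitivity (y * (1 / 2) * s + (1 - 3 * (r * r)) / 24 * s ^ 3); [rewrite E|]; field. }
  simpl; field.
Qed.

(** The exponent is [sqrt 3/2 u (T^3 (1 - u) + y T)].  On the first half of the
    chord the cubic part makes it at least [T^3 u/4]; on the second half, where
    the cubic part degenerates at [u = 1], the linear part makes it at least
    [y T/4].  Adding the two exponentials bounds both cases at once, so that the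
    integral need not be split. *)
Lemma Rabs_chord_edge_le (y u T : R) :
  0 <= y -> 0 <= T -> 0 <= u <= 1 ->
  Rabs (chord_edge y u T) <=
  2 * T * (exp (- (T ^ 3 / 4 * u)) + exp (- (y / 4 * T))).
Proof.
  intros Hy HT Hu. pose proof sqrt3_sqr as E.
  assert (Hr : 1 <= sqrt 3 <= 2) by (pose proof (sqrt_pos 3); split; nra).
  assert (H3 : 0 <= T ^ 3) by now apply pow_le.
  unfold chord_edge, airy_im.
  set (P := (_ - _) / 3 + y * (T * chord_re u)).
  replace (- _) with (- (sqrt 3 / 2 * u * (T ^ 3 * (1 - u) + y * T))).
  2: { unfold chord_re, chord_im. set (r := sqrt 3) in *.
       transitivity (- (r / 2 * u * (T ^ 3 * ((1 - u / 2) * (1 - u / 2) - r * r / 12 * (u * u)) + y * T)));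
       [rewrite E|]; field. }
  set (X := exp _).
  assert (HX : X <= exp (- (T ^ 3 / 4 * u)) + exp (- (y / 4 * T))).
  { pose proof (exp_pos (- (T ^ 3 / 4 * u))). pose proof (exp_pos (- (y / 4 * T))).
    assert (HT3 : 0 <= T ^ 3 * (1 - u)) by (apply Rmult_le_pos; lra).
    assert (HyT : 0 <= y * T) by (apply Rmult_le_pos; lra).
    assert (Hlow : u / 2 * (T ^ 3 * (1 - u) + y * T) <= sqrt 3 / 2 * u * (T ^ 3 * (1 - u) + y * T)).
    { apply Rmult_le_compat_r; [lra|]. nra. }
    assert (mono : forall v w, v <= w -> exp v <= exp w).
    { intros v w [L| ->]; [left; now apply exp_increasing | lra]. }
    destruct (Rle_dec u (1 / 2)) as [L|L].
    - apply Rle_trans with (exp (- (T ^ 3 / 4 * u))); [|lra].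
      apply mono. assert (T ^ 3 * u * (1 / 2) <= T ^ 3 * u * (1 - u)) by (apply Rmult_le_compat_l; [apply Rmult_le_pos|]; lra).
      assert (0 <= u * (y * T)) by (apply Rmult_le_pos; lra). lra.
    - apply Rle_trans with (exp (- (y / 4 * T))); [|lra].
      apply mono. assert (1 / 2 * (y * T) <= u * (y * T)) by (apply Rmult_le_compat_r; lra).
      assert (0 <= u * (T ^ 3 * (1 - u))) by (apply Rmult_le_pos; lra). lra. }
  assert (0 < X) by apply exp_pos.
  rewrite Rabs_mult, (Rabs_pos_eq X) by lra.
  assert (HB : Rabs (T * - (1 / 2) * sin P + T * (sqrt 3 / 2) * cos P) <= 2 * T).
  { pose proof (SIN_bound P). pose proof (COS_bound P).
    apply Rabs_le.
    assert (- (T / 2) <= T / 2 * sin P <= T / 2) by (split; nra).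
    assert (- T <= T * (sqrt 3 / 2) * cos P <= T).
    { assert (0 <= T * (sqrt 3 / 2) <= T) by (split; nra). split; nra. }
    lra. }
  rewrite Rmult_comm. apply Rmult_le_compat; try lra. apply Rabs_pos.
Qed.

Lemma Rabs_RInt_chord_edge_le (y T : R) : 0 <= y -> 0 < T ->
  Rabs (RInt (fun u => chord_edge y u T) 0 1) <=
  8 * (/ T * / T) + 2 * (T ^ 1 * exp (- (y / 4 * T))).
Proof.
  intros Hy HT.
  assert (H3 : 0 < T ^ 3) by now apply pow_lt.
  pose (F := fun u => 2 * T * (- / (T ^ 3 / 4) * exp (- (T ^ 3 / 4 * u)) + u * exp (- (y / 4 * T)))).
  apply Rle_trans with (F 1 - F 0).
  - apply (norm_RInt_le (V := R_NormedModule) (fun u => chord_edge y u T)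
      (fun u => 2 * T * (exp (- (T ^ 3 / 4 * u)) + exp (- (y / 4 * T)))) 0 1).
    + lra.
    + intros u Hu; apply Rabs_chord_edge_le; lra.
    + apply (RInt_correct (V := R_CompleteNormedModule)), ex_RInt_continuous_everywhere.
      intros u; apply continuous_chord_edge.
    + apply (is_RInt_derive (V := R_CompleteNormedModule)); intros u _.
      * unfold F; auto_derive; [auto|]. change (T * (T * (T * 1))) with (T ^ 3). field; lra.
      * apply (ex_derive_continuous (V := R_NormedModule)); auto_derive; auto.
  - unfold F. rewrite Rmult_0_r, Ropp_0, exp_0, Rmult_1_r.
    pose proof (exp_pos (- (T ^ 3 / 4))).
    assert (0 < / (T ^ 3 / 4)) by (apply Rinv_0_lt_compat; lra).
    apply Rle_trans with (2 * T * / (T ^ 3 / 4) + 2 * T * exp (- (y / 4 * T))).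
    + assert (0 < 2 * T * (/ (T ^ 3 / 4) * exp (- (T ^ 3 / 4)))) by (apply Rmult_lt_0_compat; [lra | nra]).
      lra.
    + right; simpl; field; lra.
Qed.

Lemma is_lim_RInt_chord_edge (y : R) : 0 < y ->
  is_lim (fun T => RInt (fun u => chord_edge y u T) 0 1) p_infty 0.
Proof.
  intros Hy.
  apply is_lim_0_dominated with (1 := fun T HT => Rabs_RInt_chord_edge_le y T (Rlt_le _ _ Hy) HT).
  replace (Finite 0) with (Finite (8 * (0 * 0) + 2 * 0)) by (f_equal; ring).
  apply is_lim_plus'.
  - assert (L : is_lim Rinv p_infty 0).
    { apply (is_lim_inv (fun s => s) p_infty p_infty); [apply is_lim_id | discriminate]. }
    apply (is_lim_scal_l (fun T => / T * / T) 8 p_infty (0 * 0)).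
    apply (is_lim_mult Rinv Rinv p_infty 0 0 L L I).
  - apply (is_lim_scal_l (fun T => T ^ 1 * exp (- (y / 4 * T))) 2 p_infty 0).
    apply is_lim_pow_exp_0; lra.
Qed.

(** Both paths give the same integral, as the edge contribution vanishes in the
    limit; this also yields the convergence of the conditionally convergent
    integral, the one along the ray being absolutely convergent. *)
Lemma is_half_line_RInt_Gi_integrand (y : R) : 0 < y ->
  is_half_line_RInt (Gi_integrand y) (half_line_RInt (ray_kernel 0 y)).
Proof.
  intros Hy.
  pose proof (is_half_line_RInt_ray_kernel 0 y Hy) as H.
  apply is_half_line_RInt_is_lim in H; [|apply continuous_ray_kernel].
  apply is_half_line_RInt_is_lim.
  { intros t; apply (ex_derive_continuous (V := R_NormedModule)).
    unfold Gi_integrand; auto_derive; auto. }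
  apply is_lim_ext with (fun T => RInt (ray_kernel 0 y) 0 T - RInt (fun u => chord_edge y u T) 0 1).
  - intros T; rewrite <- RInt_chord_kernel_ends.
    rewrite (RInt_ext (chord_kernel y 1) (ray_kernel 0 y)) by (intros; apply chord_kernel_1).
    rewrite (RInt_ext (chord_kernel y 0) (Gi_integrand y)) by (intros; apply chord_kernel_0).
    ring.
  - replace (Finite (half_line_RInt (ray_kernel 0 y))) with (Finite (half_line_RInt (ray_kernel 0 y) - 0))
      by (f_equal; ring).
    apply is_lim_minus'; [exact H | now apply is_lim_RInt_chord_edge].
Qed.

Lemma Gi_eq_ray_integral (y : R) : 0 < y ->
  Gi y = / PI * half_line_RInt (ray_kernel 0 y).
Proof.
  intros Hy; unfold Gi; f_equal.
  now apply half_line_RInt_unique, is_half_line_RInt_Gi_integrand.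
Qed.

Lemma is_derive_Gi (x : R) : 0 < x ->
  is_derive Gi x (/ PI * half_line_RInt (ray_kernel 1 x)).
Proof.
  intros Hx.
  apply is_derive_ext_loc with (fun y => / PI * half_line_RInt (ray_kernel 0 y)).
  - apply filter_imp with (fun y => 0 < y); [intros; symmetry; now apply Gi_eq_ray_integral|].
    now apply open_gt.
  - apply (is_derive_scal (fun y => half_line_RInt (ray_kernel 0 y))).
    now apply is_derive_half_line_RInt_ray_kernel.
Qed.

(** * The stated form of the error bounds *)

Lemma Rpower_3_half_integer (a b : nat) (z : R) : z = INR a + INR b / 2 ->
  Rpower 3 z = 3 ^ a * sqrt 3 ^ b.
Proof.
  intros ->. rewrite Rpower_plus, Rpower_pow by lra. f_equal.
  replace (INR b / 2) with (/ 2 * INR b) by field.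
  rewrite <- Rpower_mult, Rpower_sqrt by lra.
  apply Rpower_pow, sqrt_lt_R0; lra.
Qed.

(** As [cos (PI/6) = sqrt 3/2], the power of the decay rate contributes
    [sqrt 3 ^ (3n+4+m)], which joins the factor [3^(n+1)] of the Taylor term. *)
Lemma ray_error_bound_eq (m n : nat) (x z : R) :
  z = INR (S n) + INR (3 * n + 4 + m) / 2 ->
  INR (fact (3 * S n + m)) /
     (3 ^ S n * INR (fact (S n)) * (x * cos (PI / 6)) ^ S (3 * S n + m)) =
  INR (fact (3 * n + 3 + m)) /
     (Rpower 3 z * INR (fact (n + 1)) * (x / 2) ^ (3 * n + 4 + m)).
Proof.
  intros Hz; rewrite (Rpower_3_half_integer _ _ _ Hz), cos_PI6.
  replace (S (3 * S n + m)) with (3 * n + 4 + m)%nat by lia.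
  replace (3 * S n + m)%nat with (3 * n + 3 + m)%nat by lia.
  replace (n + 1)%nat with (S n) by lia.
  replace (x * (sqrt 3 / 2)) with (sqrt 3 * (x / 2)) by field.
  rewrite Rpow_mult_distr; f_equal; ring.
Qed.

Theorem theorem4p2 (x : R) (n : nat) (hx : 0 < x) :
  (* the integral defining Gi x converges and Gi is differentiable at x *)
  ex_RInt_gen (Gi_integrand x) (at_point 0) (Rbar_locally p_infty) /\
  ex_derive Gi x /\
  Gi x = Gi_expansion n x + / PI * Gi_error n x /\
  Derive Gi x = Gi'_expansion n x + / PI * Gi'_error n x /\
  Rabs (Gi_error n x) <=
    INR (fact (3 * n + 3)) /
    (Rpower 3 (5 * INR n / 2 + 3) * INR (fact (n + 1)) *
     (x / 2) ^ (3 * n + 4)) /\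
  Rabs (Gi'_error n x) <=
    INR (fact (3 * n + 4)) /
    (Rpower 3 ((5 * INR n + 7) / 2) * INR (fact (n + 1)) *
     (x / 2) ^ (3 * n + 5)).
Proof.
  pose proof PI_RGT_0 as HPI.
  assert (HPI_l : forall v : R, PI * (/ PI * v) = v) by (intros; field; lra).
  assert (H3 : forall k, 0 < 3 ^ k) by (intros; apply pow_lt; lra).
  assert (Hfact : forall k, 0 < INR (fact k)) by (intros; apply INR_fact_lt_0).
  assert (Hxk : forall k, 0 < x ^ k) by (intros; now apply pow_lt).
  assert (E0 : PI * Gi_expansion n x = (-1) ^ 0 * moment_sum 0 n x).
  { unfold Gi_expansion, moment_sum. simpl ((-1) ^ 0). rewrite Rmult_1_l, <- Rmult_assoc, scal_sum.
    apply sum_eq; intros k _. rewrite Nat.add_0_r, Rpow_mult_distr, <- pow_mult, <- tech_pow_Rmult.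
    specialize (Hfact k); specialize (H3 k); specialize (Hxk (3 * k)%nat).
    field; lra. }
  assert (E1 : PI * Gi'_expansion n x = (-1) ^ 1 * moment_sum 1 n x).
  { unfold Gi'_expansion, moment_sum. rewrite !Ropp_mult_distr_l, <- Rmult_assoc, !scal_sum.
    apply sum_eq; intros k _.
    replace (S (3 * k + 1)) with (2 + 3 * k)%nat by lia.
    rewrite pow_add, Rpow_mult_distr, <- pow_mult.
    specialize (Hfact k); specialize (H3 k); specialize (Hxk (3 * k)%nat).
    field; lra. }
  split; [eexists; now apply is_half_line_RInt_Gi_integrand|].
  split; [eexists; now apply is_derive_Gi|].
  split; [unfold Gi_error; field; lra|].
  split; [unfold Gi'_error; field; lra|].
  split.
  - pose proof (half_line_RInt_ray_kernel_expansion 0 n x hx) as H.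
    rewrite (ray_error_bound_eq 0 n x (5 * INR n / 2 + 3)), !Nat.add_0_r in H.
    + unfold Gi_error. rewrite Rmult_minus_distr_l, E0, Gi_eq_ray_integral by exact hx.
      rewrite HPI_l. exact H.
    + rewrite S_INR, !plus_INR, mult_INR; simpl; field.
  - pose proof (half_line_RInt_ray_kernel_expansion 1 n x hx) as H.
    rewrite (ray_error_bound_eq 1 n x ((5 * INR n + 7) / 2)) in H.
    + replace (3 * n + 5)%nat with (3 * n + 4 + 1)%nat by lia.
      replace (3 * n + 4)%nat with (3 * n + 3 + 1)%nat at 1 by lia.
      unfold Gi'_error. rewrite Rmult_minus_distr_l, E1, (is_derive_unique _ _ _ (is_derive_Gi x hx)).
      rewrite HPI_l. exact H.
    + rewrite S_INR, !plus_INR, mult_INR; simpl; field.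
Qed.
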